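(* Let $A_0$ be the universal $C^*$-algebra generated by $\alpha_0,\beta_0$ subject to the relations of $C(SU_q(2))$ at $q=0$, let $\lambda_0$ and $\pi_0$ be its representations on $\ell^2(\Gamma)$ and on $\mathcal{H}_\pi=\ell^2(\mathbb{N})\otimes\ell^2(\mathbb{Z})$ described in the context, and let $U:\ell^2(\Gamma)\to \mathcal{H}_{mult}\otimes\mathcal{H}_\pi$ be the unitary described in the context. Then for every $a\in A_0$, $$U\lambda_0(a)U^*=I\otimes\pi_0(a),$$ where $I$ is the identity operator on $\mathcal{H}_{mult}=\ell^2(\mathbb{N})$.
   Context: $\mathbb{N}=\{0,1,2,\ldots\}$. $A_0$ is the universal unital $C^*$-algebra generated by $\alpha_0,\beta_0$ with relations $$\alpha_0^*\alpha_0+\beta_0^*\beta_0=I,\quad \alpha_0\alpha_0^*=I,\quad \alpha_0\beta_0=0,\quad \alpha_0\beta_0^*=0,\quad \beta_0^*\beta_0=\beta_0\beta_0^*.$$ Representation $\pi_0$ on $\mathcal{H}_\pi=\ell^2(\mathbb{N})\otimes\ell^2(\mathbb{Z})$: $\pi_0(\alpha_0)=S\otimes I$ and $\pi_0(\beta_0)=P_0\otimes S$, where on $\ell^2(\mathbb{N})$ the operator $S$ is the left shift ($Se_k=e_{k-1}$ for $k\ge1$, $Se_0=0$), $P_0$ is the orthogonal projection onto $\mathbb{C}e_0$, and on $\ell^2(\mathbb{Z})$ the symbol $S$ denotes the unitary left shift $e_k\mapsto e_{k-1}$. Let $\Gamma=\{(n,i,j): n\in\frac12\mathbb{N},\ i,j\in\{-n,-n+1,\ldots,n-1,n\}\}$,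 and let $\{e^n_{ij}\}_{(n,i,j)\in\Gamma}$ be the canonical orthonormal basis of $\ell^2(\Gamma)$. Representation $\lambda_0$ on $\ell^2(\Gamma)$: $$\lambda_0(\alpha_0)e^n_{ij}=\begin{cases} e^{n-\frac12}_{i-\frac12,j-\frac12}&\text{if } i>-n \text{ and } j>-n,\\ 0&\text{otherwise,}\end{cases}$$ $$\lambda_0(\beta_0)e^n_{ij}=\begin{cases} -e^{n+\frac12}_{i+\frac12,j-\frac12}&\text{if } j=-n,\\ e^{n-\frac12}_{i+\frac12,j-\frac12}&\text{if } i=-n \text{ and } j\neq -n,\\ 0&\text{otherwise.}\end{cases}$$ Let $\mathcal{H}_{mult}=\ell^2(\mathbb{N})$ and let $e(r,s,t)=e_r\otimes e_s\otimes e_t$ ($r,s\in\mathbb{N}$, $t\in\mathbb{Z}$) be the canonical orthonormal basis of $\mathcal{H}_{mult}\otimes\mathcal{H}_\pi=\ell^2(\mathbb{N})\otimes\ell^2(\mathbb{N})\otimes\ell^2(\mathbb{Z})$. The unitary $U$ is given by $$Ue^n_{ij}=(-1)^{\max(i,j)-j}\,e\bigl(n-\max(i,j),\,n+\min(i,j),\,j-i\bigr).$$ Its inverse is $$U^*e(r,s,t)=(-1)^{t_-}e^{\frac{r+s+|t|}{2}}_{\frac{-r+s-t}{2},\frac{-r+s+t}{2}},\qquad t_-=\max(-t,0).$$ *)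

(* Defs.v *)
From HB Require Import structures.
From mathcomp Require Import all_boot all_order all_algebra.
From mathcomp Require Import finmap complex ring lra.
From mathcomp Require Import all_classical all_reals all_analysis.
From mathcomp.analysis.showcase Require summability.
Import Order.TTheory GRing.Theory Num.Theory.
Import numFieldNormedType.Exports.

Set Implicit Arguments.
Unset Strict Implicit.
Unset Printing Implicit Defensive.

Local Open Scope classical_set_scope.
Local Open Scope ring_scope.

Notation normc := ComplexField.Normc.normc.

(* Unital C*-algebras. [GRing.Algebra] forces 1 != 0, so the zero algebra is
   excluded; it receives exactly one map from any algebra, so this does not
   affect universal properties. The norm is real-valued and kept separate from
   the normed-module hierarchy, which has no join with rings. *)
HB.mixin Record isCStarAlgebra (R : realType) A & GRing.Algebra R[i] A := {
  star : A -> A ;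
  cnorm : A -> R ;
  starK : involutive star ;
  starD : {morph star : a b / a + b} ;
  starZ : forall (c : R[i]) (a : A), star (c *: a) = c^* *: star a ;
  starM : forall a b : A, star (a * b) = star b * star a ;
  cnorm_eq0 : forall a : A, cnorm a = 0 -> a = 0 ;
  cnormD : forall a b : A, cnorm (a + b) <= cnorm a + cnorm b ;
  cnormZ : forall (c : R[i]) (a : A), cnorm (c *: a) = normc c * cnorm a ;
  cnormM : forall a b : A, cnorm (a * b) <= cnorm a * cnorm b ;
  cnorm_star : forall a : A, cnorm (star a * a) = cnorm a ^+ 2 ;
  cnorm_complete : forall u : nat -> A,
    (forall e : R, 0 < e -> exists N, forall m n,
      (N <= m)%N -> (N <= n)%N -> cnorm (u m - u n) < e) ->
    exists l : A, forall e : R, 0 < e -> exists N, forall n,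
      (N <= n)%N -> cnorm (u n - l) < e
}.

#[short(type="cstarAlgType")]
HB.structure Definition CStarAlgebra (R : realType) :=
  {A of isCStarAlgebra R A & GRing.Algebra R[i] A}.

Definition unital_star_hom (R : realType) (A B : cstarAlgType R) (f : A -> B) :=
  [/\ linear f, monoid_morphism f & {morph f : a / star a}].

Section UniversalAlgebra.
Variable R : realType.

Record suq2_rel0 (A : cstarAlgType R) (a b : A) : Prop := Suq2Rel0 {
  rel0_sum : star a * a + star b * b = 1 ;
  rel0_coisom : a * star a = 1 ;
  rel0_ab : a * b = 0 ;
  rel0_abstar : a * star b = 0 ;
  rel0_normal : star b * b = b * star b
}.

(* The triple (A, a, b) is initial among unital C*-algebras with two elements
   satisfying the relations. Uniqueness of [f] encodes that A is generated, as
   a C*-algebra, by [a] and [b]. *)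
Definition is_universal0 (A : cstarAlgType R) (a b : A) : Prop :=
  suq2_rel0 a b /\
  forall (B : cstarAlgType R) (a' b' : B), suq2_rel0 a' b' ->
    exists! f : A -> B, [/\ unital_star_hom f, f a = a' & f b = b'].

End UniversalAlgebra.

Section Ell2.
Variable R : realType.
Local Notation C := R[i].

Lemma sqr_normcD_le (a x y : C) :
  normc (a * x + y) ^+ 2 <= 2 * normc a ^+ 2 * normc x ^+ 2 + 2 * normc y ^+ 2.
Proof.
have nn (z : C) : 0 <= normc z by case: z => u v; rewrite sqrtr_ge0.
have h : normc (a * x + y) <= normc a * normc x + normc y.
  by rewrite -ComplexField.Normc.normcM; exact: le_normcD.
apply: (@le_trans _ _ ((normc a * normc x + normc y) ^+ 2)).
  by rewrite lerXn2r// ?nnegrE ?addr_ge0 ?mulr_ge0.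
have := sqr_ge0 (normc a * normc x - normc y).
set u := normc a * normc x; rewrite -mulrA -exprMn -/u => uv.
rewrite -subr_ge0 (_ : _ - _ = (u - normc y) ^+ 2)//; ring.
Qed.

Section Space.
Variable I : choiceType.
Implicit Types f g : I -> C.

Definition sqsum f : \bar R := \esum_(i in [set: I]) (normc (f i) ^+ 2)%:E.

Definition square_summable : {pred I -> C} :=
  [pred f | (sqsum f < +oo)%E].

Lemma sqsum_ge0 f : (0 <= sqsum f)%E.
Proof. by apply: esum_ge0 => i _; rewrite lee_fin sqr_ge0. Qed.

Lemma le_esumZl (c : R) (a : I -> \bar R) : 0 <= c -> (forall i, 0 <= a i)%E ->
  (\esum_(i in [set: I]) (c%:E * a i) <= c%:E * \esum_(i in [set: I]) a i)%E.
Proof.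
move=> c0 a0; rewrite ge_ereal_sup//= => _ [X [finX _] <-].
rewrite fsbig_finite//= -ge0_sume_distrr; last by move=> i _; exact: a0.
apply: lee_wpmul2l => //; rewrite -fsbig_finite//.
by apply: esum_ge; exists X.
Qed.

Lemma square_summable_submod_closed : submod_closed square_summable.
Proof.
split=> [|a f g].
  rewrite inE /sqsum esum1 ?ltry// => i _.
  by rewrite [X in normc X](_ : _ = 0)// ComplexField.Normc.normc0 expr0n.
rewrite !inE => f_fin g_fin.
apply: (@le_lt_trans _ _ ((2 * normc a ^+ 2)%:E * sqsum f + 2%:E * sqsum g)%E).
  apply: (@le_trans _ _ (\esum_(i in [set: I])
    ((2 * normc a ^+ 2)%:E * (normc (f i) ^+ 2)%:E +
     2%:E * (normc (g i) ^+ 2)%:E)%E)).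
    apply: le_esum => i _; rewrite -!EFinM -EFinD lee_fin.
    exact: sqr_normcD_le.
  rewrite esumD => [|i _|i _]; last 2 first.
  - by rewrite -EFinM lee_fin mulr_ge0 ?sqr_ge0// mulr_ge0 ?sqr_ge0.
  - by rewrite -EFinM lee_fin mulr_ge0 ?sqr_ge0.
  apply: leeD; first apply: le_esumZl => // [|i].
  - by rewrite mulr_ge0 ?sqr_ge0.
  - by rewrite lee_fin sqr_ge0.
  - by apply: le_esumZl => // i; rewrite lee_fin sqr_ge0.
have fin h : (sqsum h < +oo)%E -> exists2 r, sqsum h = r%:E & 0 <= r.
  move=> h_fin; exists (fine (sqsum h)); last exact: fine_ge0 (sqsum_ge0 h).
  by rewrite fineK// ge0_fin_numE// sqsum_ge0.
have [r -> _] := fin _ f_fin; have [t -> _] := fin _ g_fin.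
by rewrite -!EFinM -EFinD ltry.
Qed.

HB.instance Definition _ := GRing.isSubmodClosed.Build C (I -> C)
  square_summable square_summable_submod_closed.

Record ell2 := Ell2 {
  ell2_fun :> I -> C ;
  ell2_summable : ell2_fun \in square_summable
}.

HB.instance Definition _ := [isSub for ell2_fun].
HB.instance Definition _ := [Choice of ell2 by <:].
HB.instance Definition _ := [SubChoice_isSubLmodule of ell2 by <:].

Lemma ell2_ext (x y : ell2) : x =1 y -> x = y.
Proof. by move=> xy; apply: val_inj; apply/funext. Qed.

Definition l2norm (x : ell2) : R := Num.sqrt (fine (sqsum x)).

(* Unconditional sum (limit over finite subsets), linear in [x] and
   conjugate-linear in [y]. *)
Definition inner (x y : ell2) : C :=
  summability.sum (fun i => x i * (y i)^* : C^o).

Lemma sqsumE (x : ell2) : sqsum x = (l2norm x ^+ 2)%:E.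
Proof.
have := ell2_summable x; rewrite inE => x_fin.
rewrite sqr_sqrtr ?fine_ge0 ?sqsum_ge0// fineK// ge0_fin_numE//.
exact: sqsum_ge0.
Qed.

Lemma ket_summable (i : I) : (fun j => (j == i)%:R : C) \in square_summable.
Proof.
rewrite inE /sqsum.
rewrite (eq_esum (b := fun j => if j \in [set i] then 1%E else 0%E)); last first.
  move=> j _; have [->|/eqP ji] := eqVneq j i.
    by rewrite mem_set// ComplexField.Normc.normc1 expr1n.
  by rewrite memNset// ComplexField.Normc.normc0 expr0n.
by rewrite -esum_mkcond esum_set1// ltry.
Qed.

Definition ket (i : I) : ell2 := Ell2 (ket_summable i).

End Space.

Record bop (I J : choiceType) := Bop {
  bop_fun :> ell2 I -> ell2 J ;
  bop_linear : linear bop_fun ;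
  bop_bounded : exists M : R, forall x, l2norm (bop_fun x) <= M * l2norm x
}.

HB.instance Definition _ (I J : choiceType) (T : bop I J) :=
  GRing.isLinear.Build C (ell2 I) (ell2 J) *:%R (bop_fun T) (bop_linear T).

Section Operators.
Implicit Types I J K : choiceType.

Lemma bop_ext I J (S T : bop I J) : S =1 T -> S = T.
Proof.
case: S T => [S lS bS] [T lT bT] /= /funext ST; subst T.
by congr Bop; exact: Prop_irrelevance.
Qed.

Lemma bounded_sqsum I J (T : ell2 I -> ell2 J) (M : R) : 0 <= M ->
  (forall x, (sqsum (T x) <= M%:E * sqsum x)%E) ->
  exists M : R, forall x, l2norm (T x) <= M * l2norm x.
Proof.
move=> M0 TM; exists (Num.sqrt M) => x.
have := TM x; rewrite !sqsumE -EFinM lee_fin => h.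
rewrite -[leLHS]ger0_norm ?sqrtr_ge0// -sqrtr_sqr.
rewrite -[l2norm x in leRHS]ger0_norm ?sqrtr_ge0// -sqrtr_sqr -sqrtrM//.
by rewrite ler_wsqrtr.
Qed.

Lemma bop_sqsum I J (T : bop I J) :
  exists2 M : R, 0 <= M & forall x, (sqsum (T x) <= M%:E * sqsum x)%E.
Proof.
have [M TM] := bop_bounded T; exists (M ^+ 2); first exact: sqr_ge0.
move=> x; rewrite !sqsumE -EFinM lee_fin -exprMn.
by rewrite lerXn2r ?nnegrE ?sqrtr_ge0 ?TM// (le_trans _ (TM x))// sqrtr_ge0.
Qed.

End Operators.
End Ell2.

Section BoundedOperators.
Variable R : realType.
Local Notation C := R[i].
Implicit Types I J K : choiceType.

Lemma sqsum_le_inj I K (e : K -> I) (x : I -> C) : injective e ->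
  (sqsum (x \o e) <= sqsum x)%E.
Proof.
move=> e_inj; rewrite /sqsum /= -(@esum_image _ _ _ setT e
  (fun i => (normc (x i) ^+ 2)%:E)); last by move=> ? ? _ _ /e_inj.
rewrite esum_mkcond; apply: le_esum => i _; case: ifP => // _.
by rewrite lee_fin sqr_ge0.
Qed.

Lemma sqsum_pair I J (x : I * J -> C) :
  sqsum x = (\esum_(i in [set: I]) sqsum (fun j => x (i, j)))%E.
Proof.
rewrite /sqsum esum_esum; last by move=> *; rewrite lee_fin sqr_ge0.
rewrite (_ : _ `*`` _ = setT); first by apply: eq_esum => -[].
by apply/seteqP; split=> // -[].
Qed.

Lemma comp_summable I K (e : K -> I) (x : ell2 R I) : injective e ->
  x \o e \in @square_summable R K.
Proof.
move=> e_inj; rewrite inE (le_lt_trans (sqsum_le_inj x e_inj))//.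
by have := ell2_summable x; rewrite inE.
Qed.

Lemma idfun_bounded I :
  exists M : R, forall x : ell2 R I, l2norm (idfun x) <= M * l2norm x.
Proof. by exists 1 => x; rewrite mul1r. Qed.

Definition bid I : bop R I I := Bop (fun _ _ _ => erefl) (@idfun_bounded I).

Lemma comp_linear I J K (S : bop R J K) (T : bop R I J) : linear (S \o T).
Proof. by move=> a x y /=; rewrite !linearP. Qed.

Lemma comp_bounded I J K (S : bop R J K) (T : bop R I J) :
  exists M : R, forall x, l2norm ((S \o T) x) <= M * l2norm x.
Proof.
have [M M0 SM] := bop_sqsum S; have [N N0 TN] := bop_sqsum T.
apply: (@bounded_sqsum _ _ _ _ (M * N)); first exact: mulr_ge0.
move=> x; rewrite (le_trans (SM _))// EFinM -muleA.
by rewrite lee_wpmul2l// lee_fin.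
Qed.

Definition bcomp I J K (S : bop R J K) (T : bop R I J) : bop R I K :=
  Bop (comp_linear S T) (comp_bounded S T).

Lemma zero_linear I J : linear ((fun=> 0) : ell2 R I -> ell2 R J).
Proof. by move=> a x y; rewrite scaler0 addr0. Qed.

Lemma zero_bounded I J : exists M : R, forall x : ell2 R I,
  l2norm (0 : ell2 R J) <= M * l2norm x.
Proof.
apply: (@bounded_sqsum _ _ _ (fun=> 0) 0) => // x.
rewrite mul0e /sqsum esum1// => j _.
by rewrite [X in normc X](_ : _ = 0)// ComplexField.Normc.normc0 expr0n.
Qed.

Definition bzero I J : bop R I J := Bop (@zero_linear I J) (@zero_bounded I J).

HB.instance Definition _ I J := gen_eqMixin (bop R I J).
HB.instance Definition _ I J := gen_choiceMixin (bop R I J).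

(* The bounded operator with prescribed values on the canonical basis, and 0
   when no bounded operator has these values; see [bop_of_basisE]. *)
Definition bop_of_basis I J (f : I -> ell2 R J) : bop R I J :=
  xget (bzero I J) [set T | forall i, T (ket R i) = f i].

Lemma weighted_partial_injection I J (h : I -> option J) (d : I -> C) :
  (forall i i' j, h i = Some j -> h i' = Some j -> i = i') ->
  (forall i, normc (d i) <= 1) ->
  exists T : bop R I J,
    forall i, T (ket R i) = if h i is Some j then d i *: ket R j else 0.
Proof.
move=> h_inj d1.
have nn (z : C) : 0 <= normc z by case: z => u v; rewrite sqrtr_ge0.
pose g (j : J) : option I :=
  if pselect (exists i, h i = Some j) is left P then Some (projT1 (cid P))
  else None.
have gP i j : g j = Some i <-> h i = Some j.
  rewrite /g; case: pselect => [P|nP]; split=> //.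
  - by case=> <-; exact: (projT2 (cid P)).
  - by move=> hi; congr Some; apply: h_inj hi; exact: (projT2 (cid P)).
  - by move=> hi; exfalso; apply: nP; exists i.
pose w (x : I -> C) (j : J) : C := if g j is Some i then d i * x i else 0.
have w_le x : (sqsum (w x) <= sqsum x)%E.
  pose D := [set j | exists i, g j = Some i].
  pose a (o : option I) : \bar R :=
    if o is Some i then (normc (x i) ^+ 2)%:E else 0%E.
  have a0 o : (0 <= a o)%E by case: o => //= i; rewrite lee_fin sqr_ge0.
  have gD : set_inj D g.
    move=> j j' /set_mem[i gi] _; rewrite gi => /esym/gP hi'.
    by move/gP: gi; rewrite hi' => -[].
  apply: (@le_trans _ _ (\esum_(j in D) a (g j))%E).
    rewrite [leRHS]esum_mkcond; apply: le_esum => j _.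
    rewrite /w; case gj : (g j) => [i|].
      rewrite mem_set/=; last by exists i.
      rewrite lee_fin ComplexField.Normc.normcM exprMn ler_piMl ?sqr_ge0//.
      by rewrite expr_le1.
    by rewrite ComplexField.Normc.normc0 expr0n /=; case: ifP.
  rewrite -(@esum_image _ _ _ D g a gD).
  apply: (@le_trans _ _ (\esum_(o in range (@Some I)) a o)%E).
    rewrite esum_mkcond [leRHS]esum_mkcond; apply: le_esum => o _.
    case: ifPn => [/set_mem[j [i ji] <-]|_]; last by case: ifP.
    by rewrite mem_set// ji; exists i.
  by rewrite esum_image// => ? ? _ _ [].
have wP (x : ell2 R I) : w x \in @square_summable R J.
  by rewrite inE (le_lt_trans (w_le x))//; have := ell2_summable x; rewrite inE.
pose W x := Ell2 (wP x).
have W_lin : linear W.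
  move=> a x y; apply: ell2_ext => j; rewrite /= /w.
  rewrite [RHS](_ : _ = a * w x j + w y j)// /w.
  case: (g j) => [i|]; last by rewrite mulr0 addr0.
  by rewrite [X in d i * X](_ : _ = a * x i + y i)// mulrDr mulrCA.
have W_bnd : exists M : R, forall x, l2norm (W x) <= M * l2norm x.
  by apply: (@bounded_sqsum _ _ _ _ 1) => // x; rewrite mul1e; exact: w_le.
exists (Bop W_lin W_bnd) => i; apply: ell2_ext => j /=.
rewrite /w; case hi : (h i) => [j'|].
  rewrite [RHS](_ : _ = d i * (j == j')%:R)//.
  case gj : (g j) => [i'|].
    move/gP: gj => hi'; have [jj|jj] := eqVneq j j'.
      by rewrite -(h_inj _ _ _ hi' (etrans hi (congr1 _ (esym jj)))) /= eqxx.
    rewrite /= (_ : (i' == i) = false) ?mulr0//.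
    by apply/eqP => ii; move: hi'; rewrite ii hi => -[/esym/eqP]; apply/negP.
  have [jj|_] := eqVneq j j'; last by rewrite mulr0.
  by have /gP := etrans hi (congr1 _ (esym jj)); rewrite gj.
case gj : (g j) => [i'|]//=; move/gP: gj => hi'.
rewrite (_ : (i' == i) = false) ?mulr0//.
by apply/eqP => ii; move: hi'; rewrite ii hi.
Qed.

Lemma bop_of_basisE I J (h : I -> option J) (d : I -> C) (f : I -> ell2 R J) :
  (forall i i' j, h i = Some j -> h i' = Some j -> i = i') ->
  (forall i, normc (d i) <= 1) ->
  (forall i, f i = if h i is Some j then d i *: ket R j else 0) ->
  forall i, bop_of_basis f (ket R i) = f i.
Proof.
move=> h_inj d1 fE; have [T TE] := weighted_partial_injection h_inj d1.
have : exists T : bop R I J, forall i, T (ket R i) = f i.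
  by exists T => i; rewrite TE fE.
exact: xgetPex.
Qed.

Definition is_adjoint I J (T : bop R I J) (S : bop R J I) : Prop :=
  forall x y, inner (T x) y = inner x (S y).

(* Every bounded operator between Hilbert spaces has a unique adjoint, so the
   default value of [xget] is never used. *)
Definition badj I J (T : bop R I J) : bop R J I :=
  xget (bzero J I) [set S | is_adjoint T S].

Lemma tensv_subproof I J (x : ell2 R I) (y : ell2 R J) :
  (fun p : I * J => x p.1 * y p.2) \in @square_summable R (I * J)%type.
Proof.
rewrite inE sqsum_pair.
have := ell2_summable x; have := ell2_summable y; rewrite !inE => y_fin x_fin.
apply: (@le_lt_trans _ _ ((l2norm y ^+ 2)%:E * sqsum x)%E); last first.
  by rewrite sqsumE -EFinM ltry.
apply: le_trans (le_esumZl _ _); [|exact: sqr_ge0|by move=> i; rewrite lee_fin sqr_ge0].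
apply: le_esum => i _; rewrite -sqsumE muleC.
apply: le_trans (le_esumZl _ _); [|exact: sqr_ge0|by move=> j; rewrite lee_fin sqr_ge0].
apply: le_esum => j _.
by rewrite -EFinM lee_fin /= ComplexField.Normc.normcM exprMn.
Qed.

(* The Hilbert tensor product of l^2(I) and l^2(J) is realised as l^2(I * J),
   with [ket (i, j)] standing for the tensor product of [ket i] and [ket j]. *)
Definition tensv I J (x : ell2 R I) (y : ell2 R J) : ell2 R (I * J)%type :=
  Ell2 (tensv_subproof x y).

Lemma slice_inj I J (i : I) : injective (fun j : J => (i, j)).
Proof. by move=> j j' []. Qed.

Definition slice I J (x : ell2 R (I * J)%type) (i : I) : ell2 R J :=
  Ell2 (comp_summable x (@slice_inj I J i)).

Lemma ampl_sqsum I J (T : bop R J J) : exists2 M : R, 0 <= M &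
  forall x : ell2 R (I * J)%type,
    (sqsum (fun p : I * J => T (slice x p.1) p.2) <= M%:E * sqsum x)%E.
Proof.
have [M M0 TM] := bop_sqsum T; exists M => // x; rewrite !sqsum_pair.
apply: le_trans (le_esumZl _ _) => //; last by move=> i; exact: sqsum_ge0.
by apply: le_esum => i _; exact: TM (slice x i).
Qed.

Lemma ampl_summable I J (T : bop R J J) (x : ell2 R (I * J)%type) :
  (fun p : I * J => T (slice x p.1) p.2) \in @square_summable R (I * J)%type.
Proof.
have [M M0 TM] := @ampl_sqsum I J T.
by rewrite inE (le_lt_trans (TM x))// sqsumE -EFinM ltry.
Qed.

Definition ampl_fun I J (T : bop R J J) (x : ell2 R (I * J)%type) :
  ell2 R (I * J)%type := Ell2 (ampl_summable T x).

Lemma ampl_linear I J (T : bop R J J) : linear (@ampl_fun I J T).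
Proof.
move=> a x y; apply: ell2_ext => -[i j] /=.
have -> : slice (a *: x + y) i = a *: slice x i + slice y i by exact: ell2_ext.
by rewrite linearP.
Qed.

Lemma ampl_bounded I J (T : bop R J J) :
  exists M : R, forall x, l2norm (@ampl_fun I J T x) <= M * l2norm x.
Proof.
have [M M0 TM] := @ampl_sqsum I J T.
by apply: (@bounded_sqsum _ _ _ _ M) => // x; exact: TM.
Qed.

(* The operator 1 (x) T. *)
Definition ampl I J (T : bop R J J) : bop R (I * J)%type (I * J)%type :=
  Bop (@ampl_linear I J T) (@ampl_bounded I J T).

Lemma swap_inj I J : injective (fun p : J * I => (p.2, p.1)).
Proof. by move=> [? ?] [? ?] [-> ->]. Qed.

Definition swap_fun I J (x : ell2 R (I * J)%type) : ell2 R (J * I)%type :=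
  Ell2 (comp_summable x (@swap_inj I J)).

Lemma swap_linear I J : linear (@swap_fun I J).
Proof. by move=> a x y; apply: ell2_ext. Qed.

Lemma swap_bounded I J :
  exists M : R, forall x, l2norm (@swap_fun I J x) <= M * l2norm x.
Proof.
apply: (@bounded_sqsum _ _ _ _ 1) => // x; rewrite mul1e.
exact: sqsum_le_inj (@swap_inj I J).
Qed.

Definition bswap I J : bop R (I * J)%type (J * I)%type :=
  Bop (@swap_linear I J) (@swap_bounded I J).

(* The operator S (x) T = (S (x) 1) (1 (x) T), where S (x) 1 is obtained by
   conjugating 1 (x) S with the flip. *)
Definition btens I J (S : bop R I I) (T : bop R J J) :
    bop R (I * J)%type (I * J)%type :=
  bcomp (bcomp (bswap J I) (bcomp (ampl J S) (bswap I J))) (ampl I T).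

Lemma btensE I J (S : bop R I I) (T : bop R J J) (x : ell2 R I) (y : ell2 R J) :
  btens S T (tensv x y) = tensv (S x) (T y).
Proof.
apply: ell2_ext => -[i j].
rewrite [LHS](_ : _ = S (slice (bswap I J (ampl I T (tensv x y))) j) i)//.
have -> : slice (bswap I J (ampl I T (tensv x y))) j = (T y) j *: x.
  apply: ell2_ext => i'.
  rewrite [LHS](_ : _ = T (slice (tensv x y) i') j)//.
  have -> : slice (tensv x y) i' = x i' *: y by exact: ell2_ext.
  by rewrite linearZ; exact: mulrC.
by rewrite linearZ; exact: mulrC.
Qed.

Lemma inner_ket I (x : ell2 R I) (i : I) : inner x (ket R i) = x i.
Proof.
have totallyF := @summability.totally_filter I.
rewrite /inner /summability.sum.
apply: (@cvg_lim C^o) => //.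
apply: cvg_near_cst.
exists [fset i]%fset => //= A; rewrite /= fsub1set => iA.
rewrite /summability.partial_sum (bigD1 [` iA]%fset)//= big1 ?addr0.
  by rewrite eqxx conjC1 mulr1.
move=> k; rewrite -val_eqE /= => /negPf ->; by rewrite conjC0 mulr0.
Qed.

End BoundedOperators.

Record is_representation (R : realType) (A : cstarAlgType R) (I : choiceType)
    (rho : A -> bop R I I) : Prop := IsRepresentation {
  rep_linear : forall (c : R[i]) (a b : A) (x : ell2 R I),
    rho (c *: a + b) x = c *: rho a x + rho b x ;
  rep_unit : rho 1 = bid R I ;
  rep_mul : forall a b : A, rho (a * b) = bcomp (rho a) (rho b) ;
  rep_star : forall a : A, is_adjoint (rho a) (rho (star a))
}.

(* (n, i, j) with n a half-integer and i, j in {-n, -n+1, ..., n-1, n}. *)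
Definition in_Gamma : pred (rat * rat * rat) := fun p =>
  let: (n, i, j) := p in
  [&& n *+ 2 \is a Num.nat, n + i \is a Num.nat, i <= n,
      n + j \is a Num.nat & j <= n].

Definition Gamma := {p : rat * rat * rat | in_Gamma p}.

Section Operators0.
Variable R : realType.

(* e^n_{ij}, extended by 0 to triples outside Gamma. *)
Definition ketG (n i j : rat) : ell2 R Gamma :=
  if insub (n, i, j) is Some g then ket R g else 0.

Definition shiftN : bop R nat nat :=
  bop_of_basis (fun k => if k is k'.+1 then ket R k' else 0).

Definition proj0 : bop R nat nat :=
  bop_of_basis (fun k => if k == 0%N then ket R 0%N else 0).

Definition shiftZ : bop R int int := bop_of_basis (fun k => ket R (k - 1)).

(* The truncations and the floor are exact on Gamma; see [UmultE]. *)
Definition Umult : bop R Gamma (nat * (nat * int))%type :=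
  bop_of_basis (fun g : Gamma =>
    let: (n, i, j) := val g in
    (-1) ^+ Num.truncn (Num.max i j - j) *:
    ket R (Num.truncn (n - Num.max i j),
           (Num.truncn (n + Num.min i j), Num.floor (j - i)))).

Lemma normc_sign (k : nat) : normc ((-1) ^+ k : R[i]) = 1.
Proof.
have n1 : normc (-1 : R[i]) = 1 by rewrite /= oppr0 expr0n addr0 sqrrN expr1n sqrtr1.
by elim: k => [|k IH]; rewrite ?expr0 ?ComplexField.Normc.normc1// exprS
  ComplexField.Normc.normcM n1 IH mulr1.
Qed.

Lemma shiftNE k : shiftN (ket R k) = if k is k'.+1 then ket R k' else 0.
Proof.
apply: (@bop_of_basisE _ _ _ (fun k => if k is k'.+1 then Some k' else None)
  (fun=> 1)) => [[|i] [|i'] j // [->] [->]//|i|[|i]//].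
  by rewrite ComplexField.Normc.normc1.
by rewrite scale1r.
Qed.

Lemma proj0E k : proj0 (ket R k) = if k == 0%N then ket R 0%N else 0.
Proof.
apply: (@bop_of_basisE _ _ _ (fun k => if k is 0 then Some 0%N else None)
  (fun=> 1)) => [[|i] [|i'] j //|i|[|i]//].
  by rewrite ComplexField.Normc.normc1.
by rewrite scale1r.
Qed.

Lemma shiftZE k : shiftZ (ket R k) = ket R (k - 1).
Proof.
apply: (@bop_of_basisE _ _ _ (fun k => Some (k - 1)) (fun=> 1)) => [i i' j|i|i].
- by move=> [<-] [] /addIr.
- by rewrite ComplexField.Normc.normc1.
- by rewrite scale1r.
Qed.

Lemma in_Gamma_int n i j : in_Gamma (n, i, j) ->
  [/\ Num.max i j - j \is a Num.nat, n - Num.max i j \is a Num.nat,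
      n + Num.min i j \is a Num.nat & j - i \is a Num.int].
Proof.
case/and5P => n2 ni i_le nj j_le.
have sub_nat (x y : rat) : x \is a Num.nat -> y \is a Num.nat -> y <= x ->
    x - y \is a Num.nat.
  by rewrite !natrEint subr_ge0 => /andP[xn _] /andP[yn _] ->; rewrite rpredB.
have e (x y z : rat) : x - y = (z + x) - (z + y) by ring.
have e2 (x : rat) : n - x = n *+ 2 - (n + x) by rewrite mulr2n; ring.
have ni' : n - i \is a Num.nat.
  by rewrite e2 sub_nat// mulr2n lerD2l.
have nj' : n - j \is a Num.nat.
  by rewrite e2 sub_nat// mulr2n lerD2l.
split.
- case: leP => ij; first by rewrite subrr.
  by rewrite (e _ _ n) sub_nat// lerD2l ltW.
- by case: leP.
- by case: leP.
- move: ni nj; rewrite !natrEint (e _ _ n) => /andP[ni _] /andP[nj _].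
  by rewrite rpredB.
Qed.

Lemma UmultE (n i j : rat) : in_Gamma (n, i, j) ->
  exists r s k : nat, exists t : int,
    [/\ r%:R = n - Num.max i j, s%:R = n + Num.min i j, t%:~R = j - i &
        k%:R = Num.max i j - j] /\
    Umult (ketG n i j) = (-1) ^+ k *: ket R (r, (s, t)).
Proof.
move=> nij; have [h1 h2 h3 h4] := in_Gamma_int nij.
exists (Num.truncn (n - Num.max i j)), (Num.truncn (n + Num.min i j)).
exists (Num.truncn (Num.max i j - j)), (Num.floor (j - i)).
split; first by split; rewrite ?truncnK ?floorK.
rewrite /ketG insubT /=.
pose h (g : Gamma) := let: (n, i, j) := val g in
  (Num.truncn (n - Num.max i j), (Num.truncn (n + Num.min i j), Num.floor (j - i))).
pose d (g : Gamma) : R[i] := let: (n, i, j) := val g in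
  (-1) ^+ Num.truncn (Num.max i j - j).
rewrite /Umult (@bop_of_basisE _ _ _ (fun g => Some (h g)) d)//.
- move=> [[[n1 i1] j1] g1] [[[n2 i2] j2] g2] _ [<-] [].
  have [_ a2 a3 a4] := in_Gamma_int g1; have [_ b2 b3 b4] := in_Gamma_int g2.
  rewrite /h /= => /(congr1 (fun k => k%:R : rat)) + /(congr1 (fun k => k%:R : rat)).
  move=> + + /(congr1 (fun k => k%:~R : rat)).
  rewrite !truncnK// !floorK// => r s t; apply: val_inj => /=.
  move: r s t {g1 g2 a2 a3 a4 b2 b3 b4}; case: (leP i1 j1); case: (leP i2 j2);
    by move=> *; congr (_, _, _); lra.
- by move=> [[[n1 i1] j1] g1]; rewrite /d /= normc_sign.
- by move=> [[[n1 i1] j1] g1].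
Qed.

End Operators0.

Section Representations0.
Variables (R : realType) (A : cstarAlgType R).
Implicit Types alpha beta : A.

Record is_pi0 alpha beta (pi : A -> bop R (nat * int)%type (nat * int)%type) :
    Prop := IsPi0 {
  pi0_rep : is_representation pi ;
  pi0_alpha : pi alpha = btens (shiftN R) (bid R int) ;
  pi0_beta : pi beta = btens (proj0 R) (shiftZ R)
}.

Record is_lambda0 alpha beta (lambda : A -> bop R Gamma Gamma) : Prop :=
    IsLambda0 {
  lambda0_rep : is_representation lambda ;
  lambda0_alpha : forall n i j : rat, in_Gamma (n, i, j) ->
    lambda alpha (ketG R n i j) =
    if (- n < i) && (- n < j) then
      ketG R (n - 1 / 2) (i - 1 / 2) (j - 1 / 2)
    else 0 ;
  lambda0_beta : forall n i j : rat, in_Gamma (n, i, j) ->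
    lambda beta (ketG R n i j) =
    if j == - n then - ketG R (n + 1 / 2) (i + 1 / 2) (j - 1 / 2)
    else if i == - n then ketG R (n - 1 / 2) (i + 1 / 2) (j - 1 / 2)
    else 0
}.

End Representations0.

(* Main.v *)
(* A representation of a C*-algebra on l^2(I) is contractive, so the set on
   which two representations agree is a closed *-subalgebra; when they agree on
   the generators of A_0, initiality of A_0 makes this subalgebra all of A_0.
   This is applied to lambda_0 and a |-> U^* (1 (x) pi_0(a)) U, whose values on
   the generators are compared on the canonical basis, written as
   U^* e(r,s,t) = (-1)^(t_-) e^((r+s+|t|)/2)_((-r+s-t)/2, (-r+s+t)/2). *)
Require Import Defs.
From mathcomp Require Import all_boot all_order all_algebra complex.
From mathcomp Require Import all_classical all_reals all_analysis.
From HB Require Import structures.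
From mathcomp Require Import finmap ring lra.
From mathcomp.analysis.showcase Require summability.
Import Order.TTheory GRing.Theory Num.Theory.
Import numFieldNormedType.Exports.

Set Implicit Arguments.
Unset Strict Implicit.
Unset Printing Implicit Defensive.

Local Open Scope classical_set_scope.
Local Open Scope ring_scope.

(** * The inner product of l^2 *)

(** The universal property speaks of C*-algebras, whereas representations take values in [bop],
    whose elements are bounded but which carries no norm or C*-structure here. Two representations
    are thus not compared as two arrows out of $A_0$; the comparison takes place inside $A_0$, on
    the set where they agree. Contractivity enters only for the closedness of that set, and is
    reached by elementary means: the infimum of the constants $m$ with $|\rho(a)x|^2\le m|x|^2$
    cannot exceed $|a|^2$, because any such $m>|a|^2$ can be lowered. Density of the finite
    combinations of basis vectors turns equalities of matrix entries into equalities of operators,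
    and conjugate symmetry of entries into adjointness. *)

Lemma normc_real (R : realType) (r : R) : normc (r%:C%C) = `|r|.
Proof. by rewrite /= expr0n addr0 sqrtr_sqr. Qed.

Lemma normc_ge0 (R : realType) (z : R[i]) : 0 <= normc z.
Proof. by case: z => u v; rewrite sqrtr_ge0. Qed.

Lemma mulr_conj_normc (R : realType) (z : R[i]) : z * z^* = (normc z ^+ 2)%:C%C.
Proof. by rewrite -normCK rmorphXn. Qed.

Section InnerProduct.
Context {R : realType} {I : choiceType}.
Local Notation C := R[i].
Implicit Types x y z : ell2 R I.

Let totallyF := @summability.totally_filter I.
#[local] Existing Instance totallyF.

Lemma l2norm_ge0 x : 0 <= l2norm x.
Proof. exact: sqrtr_ge0. Qed.

Lemma sum_fset_le x (A : {fset I}) :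
  \sum_(i <- A) normc (x i) ^+ 2 <= l2norm x ^+ 2.
Proof.
rewrite -lee_fin -sqsumE -sumEFin.
apply: esum_ge; exists [set` A]; first by split => //; exact: finite_fset.
by rewrite fsbig_finite//= set_fsetK.
Qed.

Lemma sum_fset_adherent x (e : R) : 0 < e ->
  exists A : {fset I}, l2norm x ^+ 2 - e < \sum_(i <- A) normc (x i) ^+ 2.
Proof.
move=> e0; have sE := sqsumE x; rewrite /sqsum /esum in sE.
have [|_ [X [finX _] <-]] := @ub_ereal_sup_adherent _
  [set \sum_(i \in A) (normc (x i) ^+ 2)%:E | A in fsets setT]%E _ e0.
  by rewrite sE.
rewrite sE fsbig_finite//= sumEFin -EFinB lte_fin => h.
by exists (fset_set X).
Qed.

Lemma cvg_partial_sum_sqr x :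
  summability.partial_sum (fun i => x i * (x i)^* : C^o) @ summability.totally
    --> ((l2norm x ^+ 2)%:C%C : C^o).
Proof.
apply/cvgrPdist_lt => e e0.
(* Distances in [C] are themselves complex, but a positive element of [C] is real. *)
have [r rE] : exists r : R, e = r%:C%C.
  by exists (complex.Re e); rewrite RRe_real// gtr0_real.
move: e0; rewrite rE ltcR => r0.
have [A hA] := sum_fset_adherent x r0.
exists A => // B /= AB.
rewrite /summability.partial_sum -(big_seq_fsetE _ B predT (fun i => x i * (x i)^*)).
rewrite (eq_bigr _ (fun i _ => mulr_conj_normc (x i))) -rmorph_sum -rmorphB /=.
rewrite normc_def /= expr0n addr0 ltcR sqrtr_sqr ger0_norm.
  rewrite ltrBlDr -ltrBlDl (lt_le_trans hA)//.
  rewrite [leRHS](big_fsetID _ (mem A))/=.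
  rewrite (_ : [fset i in B | i \in A]%fset = A).
    by rewrite lerDl sumr_ge0// => i _; exact: sqr_ge0.
  by apply/fsetP => i; rewrite !inE /= andb_idl// => /(fsubsetP AB).
by rewrite subr_ge0 sum_fset_le.
Qed.

Lemma polarization (a b : C) : a * b^* =
  4^-1 * ((a + b) * (a + b)^* - (a - b) * (a - b)^*
    + 'i * ((a + 'i * b) * (a + 'i * b)^*) - 'i * ((a - 'i * b) * (a - 'i * b)^*)).
Proof.
rewrite !rmorphB !rmorphD !rmorphM /= conjCi.
apply: (@mulfI _ 4); first by rewrite pnatr_eq0.
rewrite [RHS]mulrA mulfV ?pnatr_eq0// mul1r.
have i2 := sqrCi C; set j := 'i in i2 *.
transitivity ((2 - 2 * j ^+ 2) * (a * b^*) + (2 + 2 * j ^+ 2) * (b * a^*)); last by ring.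
by rewrite i2; ring.
Qed.

(** By [polarization] the partial sums are a linear combination of four diagonal ones, each of which
    converges to a squared norm. *)
Lemma cvg_inner x y :
  summability.partial_sum (fun i => x i * (y i)^* : C^o) @ summability.totally
    --> (inner x y : C^o).
Proof.
suff : cvg (summability.partial_sum (fun i => x i * (y i)^* : C^o)
  @ summability.totally) by [].
pose s z := summability.partial_sum (fun i => z i * (z i)^* : C^o).
have -> : summability.partial_sum (fun i => x i * (y i)^* : C^o) =
    (fun A => 4^-1 *: (s (x + y) A - s (x - y) A
      + 'i *: s (x + 'i *: y) A - 'i *: s (x - 'i *: y) A)).
  apply/funext => A; rewrite /s /summability.partial_sum !scaler_sumr.
  rewrite -!sumrB -!big_split -sumrB scaler_sumr.
  apply: eq_bigr => i _; exact: polarization.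
have sE z : cvg (s z @ summability.totally).
  by apply: cvgP; exact: cvg_partial_sum_sqr.
apply: is_cvgZr; apply: is_cvgB.
  by apply: is_cvgD; [exact: is_cvgB|exact: is_cvgZr].
exact: is_cvgZr.
Qed.

Lemma inner_cvg_eq x y (l : C^o) :
  summability.partial_sum (fun i => x i * (y i)^* : C^o) @ summability.totally
    --> l -> inner x y = l.
Proof. by apply: cvg_lim. Qed.

Lemma inner_sqr x : inner x x = (l2norm x ^+ 2)%:C%C.
Proof. exact/inner_cvg_eq/cvg_partial_sum_sqr. Qed.

Lemma inner_linear_l y : scalar (fun x => inner x y).
Proof.
move=> a x z; apply: inner_cvg_eq.
rewrite [X in X @ _](_ : _ = fun A =>
    a *: summability.partial_sum (fun i => x i * (y i)^* : C^o) A +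
    summability.partial_sum (fun i => z i * (y i)^* : C^o) A); last first.
  apply/funext => A; rewrite /summability.partial_sum scaler_sumr -big_split.
  by apply: eq_bigr => i _; rewrite mulrDl -mulrA.
by apply: cvgD; [apply: cvgZr|]; exact: cvg_inner.
Qed.

Lemma inner_conj x y : (inner x y)^* = inner y x.
Proof.
apply/esym/inner_cvg_eq.
rewrite [X in X @ _](_ : _ = fun A =>
    (summability.partial_sum (fun i => x i * (y i)^* : C^o) A)^*); last first.
  apply/funext => A; rewrite /summability.partial_sum rmorph_sum.
  by apply: eq_bigr => i _; rewrite rmorphM /= conjCK mulrC.
apply/cvgrPdist_lt => e e0.
have /cvgrPdist_lt/(_ e e0) := @cvg_inner x y.
apply: filterS => A; by rewrite -rmorphB norm_conjC.
Qed.

Lemma inner0l y : inner 0 y = 0.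
Proof. by have := inner_linear_l y (-1) 0 0; rewrite scaler0 addr0 mulN1r addNr. Qed.

Lemma innerDl x z y : inner (x + z) y = inner x y + inner z y.
Proof. by have := inner_linear_l y 1 x z; rewrite scale1r mul1r. Qed.

Lemma innerZl a x y : inner (a *: x) y = a * inner x y.
Proof. by have := inner_linear_l y a x 0; rewrite addr0 inner0l addr0. Qed.

Lemma innerNl x y : inner (- x) y = - inner x y.
Proof. by rewrite -scaleN1r innerZl mulN1r. Qed.

Lemma innerDr x y z : inner x (y + z) = inner x y + inner x z.
Proof. by rewrite -inner_conj innerDl rmorphD /= !inner_conj. Qed.

Lemma innerZr a x y : inner x (a *: y) = a^* * inner x y.
Proof. by rewrite -inner_conj innerZl rmorphM /= inner_conj. Qed.

Lemma innerNr x y : inner x (- y) = - inner x y.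
Proof. by rewrite -inner_conj innerNl rmorphN /= inner_conj. Qed.

Lemma l2normB_sqr x y : (l2norm (x - y) ^+ 2)%:C%C =
  (l2norm x ^+ 2)%:C%C - inner x y - inner y x + (l2norm y ^+ 2)%:C%C :> C.
Proof.
rewrite -!inner_sqr innerDl !innerDr !innerNl !innerNr opprK; ring.
Qed.

Lemma l2norm0 : l2norm (0 : ell2 R I) = 0.
Proof.
by apply/eqP; rewrite -sqrf_eq0; apply/eqP/complexI; rewrite -inner_sqr inner0l.
Qed.

Lemma l2norm_ket (i : I) : l2norm (ket R i) = 1.
Proof.
apply/eqP; rewrite -(@pexpr_eq1 _ _ 2) ?l2norm_ge0//; apply/eqP/complexI.
by rewrite -inner_sqr inner_ket /= eqxx.
Qed.

Lemma normc_le_l2norm x i : normc (x i) <= l2norm x.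
Proof.
rewrite -ler_sqr ?nnegrE ?normc_ge0 ?l2norm_ge0//.
by have := sum_fset_le x [fset i]%fset; rewrite big_seq_fset1.
Qed.

Lemma l2norm_eq0 x : l2norm x = 0 -> x = 0.
Proof.
move=> x0; apply: ell2_ext => i; apply: ComplexField.Normc.eq0_normc.
by apply/eqP; rewrite eq_le normc_ge0 -x0 normc_le_l2norm.
Qed.

Lemma l2normZ a x : l2norm (a *: x) = normc a * l2norm x.
Proof.
apply/eqP; rewrite -(@eqrXn2 _ 2) ?mulr_ge0 ?normc_ge0 ?l2norm_ge0//; apply/eqP/complexI.
rewrite -inner_sqr innerZl innerZr mulrA mulr_conj_normc inner_sqr -rmorphM.
by rewrite exprMn.
Qed.

(** With a real inner product the two cross terms coincide, so the expansion lives in [R]. It serves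
    for pairs such as $x$ and $T^*Tx$, whose inner product is $|Tx|^2$. *)
Lemma l2normB_real_inner x y (c r : R) : inner x y = r%:C%C ->
  l2norm (x - c%:C%C *: y) ^+ 2 =
  l2norm x ^+ 2 - 2 * c * r + c ^+ 2 * l2norm y ^+ 2.
Proof.
move=> xy; apply: complexI; rewrite l2normB_sqr innerZl innerZr.
rewrite -[inner y x]inner_conj xy l2normZ exprMn.
rewrite normc_real real_normK ?num_real// (_ : (c%:C%C)^* = c%:C%C); last exact: conjc_real.
rewrite (_ : (r%:C%C)^* = r%:C%C); last exact: conjc_real.
move: (l2norm x ^+ 2) (l2norm y ^+ 2) => p q.
rewrite expr2 !(rmorphD, rmorphB, rmorphM, rmorph_nat) /=; ring.
Qed.

(** The vector $|y|^2x-\langle x,y\rangle y$ has squared norm $|y|^2(|x|^2|y|^2-|\langle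
    x,y\rangle|^2)\ge 0$; this scaling avoids division. *)
Lemma cauchy_schwarz x y : normc (inner x y) <= l2norm x * l2norm y.
Proof.
have [y0|y0] := eqVneq (l2norm y) 0.
  by rewrite (l2norm_eq0 y0) -inner_conj inner0l conjC0 l2norm0 mulr0
    ComplexField.Normc.normc0.
have yp : 0 < l2norm y by rewrite lt_def y0 l2norm_ge0.
rewrite -ler_sqr ?nnegrE ?mulr_ge0 ?normc_ge0 ?l2norm_ge0//.
have e : (l2norm ((l2norm y ^+ 2)%:C%C *: x - inner x y *: y) ^+ 2)%:C%C =
  (l2norm y ^+ 2 * (l2norm x ^+ 2 * l2norm y ^+ 2 - normc (inner x y) ^+ 2))%:C%C :> C.
  rewrite -inner_sqr !(innerDl, innerDr, innerNl, innerNr, innerZl, innerZr).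
  rewrite !inner_sqr -[inner y x]inner_conj.
  move: (l2norm y ^+ 2) (l2norm x ^+ 2) (inner x y) => p q c.
  rewrite (_ : (p%:C%C)^* = p%:C%C); last exact: conjc_real.
  by rewrite rmorphM rmorphB rmorphM /= -mulr_conj_normc; ring.
have := sqr_ge0 (l2norm ((l2norm y ^+ 2)%:C%C *: x - inner x y *: y)).
by rewrite (complexI e) pmulr_rge0 ?exprn_gt0// subr_ge0 exprMn.
Qed.

Lemma l2normB x y : l2norm (x - y) <= l2norm x + l2norm y.
Proof.
rewrite -ler_sqr ?nnegrE ?addr_ge0 ?l2norm_ge0//.
have tri (p q : R) (c d : C) : 0 <= p -> 0 <= q ->
    normc (p%:C%C - c - d + q%:C%C) <= p + normc c + normc d + q.
  move=> p0 q0; apply: (le_trans (le_normcD _ _)).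
  rewrite [in leLHS]normc_real (ger0_norm q0) lerD2r.
  apply: (le_trans (le_normcD _ _)); rewrite normcN lerD2r.
  by apply: (le_trans (le_normcD _ _)); rewrite normcN normc_real ger0_norm.
have := tri _ _ (inner x y) (inner y x) (sqr_ge0 (l2norm x)) (sqr_ge0 (l2norm y)).
rewrite -l2normB_sqr normc_real ger0_norm ?sqr_ge0// => /le_trans; apply.
have := cauchy_schwarz x y; have := cauchy_schwarz y x.
by rewrite sqrrD; lra.
Qed.

End InnerProduct.

(** * Density of the canonical basis *)

Section Density.
Context {R : realType}.
Local Notation C := R[i].
Implicit Types I J : choiceType.

Lemma inner_suml I (T : Type) (r : seq T) (F : T -> ell2 R I) (y : ell2 R I) :
  inner (\sum_(i <- r) F i) y = \sum_(i <- r) inner (F i) y.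
Proof.
apply: (big_morph (fun x => inner x y)); first by move=> ? ?; exact: innerDl.
exact: inner0l.
Qed.

(** The truncation to [A] is orthogonal to the remainder, so by Pythagoras the squared error is the
    tail of the sum of squares. *)
Lemma finite_approx I (x : ell2 R I) (e : R) : 0 < e -> exists A : {fset I},
  l2norm (x - \sum_(i <- A) x i *: ket R i) ^+ 2 < e.
Proof.
move=> e0; have [A hA] := sum_fset_adherent x e0; exists A.
set x' := \sum_(i <- A) _.
have x'E i : i \in A -> x' i = x i.
  move=> iA; rewrite -inner_ket inner_suml (big_fsetD1 i)//= big1_seq ?addr0.
    by rewrite innerZl inner_ket /= eqxx mulr1.
  move=> j /andP[_]; rewrite !inE => /andP[ji _].
  by rewrite innerZl inner_ket /= eq_sym (negPf ji) mulr0.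
have orth : inner (x - x') x' = 0.
  rewrite -inner_conj inner_suml big1_seq ?rmorph0// => i /andP[_ iA].
  rewrite innerZl -inner_conj inner_ket.
  by rewrite (_ : (x - x') i = x i - x' i)// x'E// subrr conjC0 mulr0.
have x'x : inner x x' = \sum_(i <- A) (normc (x i) ^+ 2)%:C%C.
  rewrite -inner_conj inner_suml rmorph_sum; apply: eq_bigr => i _.
  by rewrite innerZl rmorphM /= -inner_conj inner_ket conjCK mulrC mulr_conj_normc.
suff -> : l2norm (x - x') ^+ 2 = l2norm x ^+ 2 - \sum_(i <- A) normc (x i) ^+ 2.
  by rewrite ltrBlDr addrC -ltrBlDr.
apply: complexI; rewrite rmorphB rmorph_sum -x'x -!inner_sqr.
have := orth; rewrite innerDl innerNl => /eqP; rewrite subr_eq0 => /eqP x'x'.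
rewrite innerDr innerNr orth subr0 innerDl innerNl; congr (_ - _); first exact: inner_sqr.
by rewrite -inner_conj x'x' inner_conj.
Qed.

Lemma bounded_scalar_eq0 I (f : ell2 R I -> C) (M : R) : scalar f ->
  (forall x, normc (f x) <= M * l2norm x) -> (forall i, f (ket R i) = 0) ->
  forall x, f x = 0.
Proof.
move=> f_lin fM f0 x; apply/eqP/negPn/negP => fx0.
have t0 : 0 < normc (f x).
  by rewrite lt_def normc_ge0 andbT; apply: contra fx0 => /eqP/ComplexField.Normc.eq0_normc ->.
have M1 : 0 < M ^+ 2 + 1 by rewrite ltr_wpDl ?sqr_ge0.
(* The [+ 1] keeps the denominator positive and makes $M^2$ times this error strictly smaller than
   $|f(x)|^2$, which is the contradiction. *)
have e0 : 0 < normc (f x) ^+ 2 / (M ^+ 2 + 1) by rewrite divr_gt0 ?exprn_gt0.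
have [A hA] := finite_approx x e0.
set x' := \sum_(i <- A) _ in hA.
have f00 : f 0 = 0 by have := f_lin (-1) 0 0; rewrite scaler0 addr0 mulN1r addNr.
have fD u v : f (u + v) = f u + f v by have := f_lin 1 u v; rewrite scale1r mul1r.
have fx' : f x' = 0.
  rewrite /x' (big_morph f fD f00) big1// => i _.
  by have := f_lin (x i) (ket R i) 0; rewrite addr0 f00 addr0 f0 mulr0.
have fxx' : f (x - x') = f x
  by have := fD (x - x') x'; rewrite subrK fx' addr0.
have := fM (x - x'); rewrite fxx' => h.
have {}h : normc (f x) ^+ 2 <= M ^+ 2 * l2norm (x - x') ^+ 2.
  by rewrite -exprMn lerXn2r ?nnegrE ?normc_ge0// (le_trans _ h) ?normc_ge0.
have : normc (f x) ^+ 2 <= M ^+ 2 * (normc (f x) ^+ 2 / (M ^+ 2 + 1)).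
  by apply: le_trans h _; rewrite ler_wpM2l ?sqr_ge0// ltW.
rewrite mulrA ler_pdivlMr// mulrDr mulr1 [M ^+ 2 * _]mulrC gerDl.
by rewrite leNgt exprn_gt0.
Qed.

(** Each coordinate of $Sx-Tx$ is a bounded functional of $x$ that vanishes on the basis. *)
Lemma bop_eq_ket I J (S T : bop R I J) :
  (forall i, S (ket R i) = T (ket R i)) -> S = T.
Proof.
move=> ST; apply: bop_ext => x; apply: ell2_ext => j; apply/eqP.
rewrite -subr_eq0; apply/eqP.
have [M SM] := bop_bounded S; have [N TN] := bop_bounded T.
apply: (@bounded_scalar_eq0 I (fun x => S x j - T x j) (M + N)) => {x}.
- move=> a x y.
  have WP (W : bop R I J) : W (a *: x + y) j = a * W x j + W y j.
    by rewrite linearP.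
  by rewrite !WP; ring.
- move=> x; apply: (le_trans (le_normcD _ _)).
  rewrite normcN mulrDl lerD// (le_trans (normc_le_l2norm _ _))//.
- by move=> i; rewrite ST subrr.
Qed.

(** Density is used once per argument: for [x] against a fixed basis vector, then for [y] after
    conjugation, since [inner] is only conjugate-linear there. *)
Lemma is_adjoint_ket I J (T : bop R I J) (S : bop R J I) :
  (forall i j, T (ket R i) j = (S (ket R j) i)^*) -> is_adjoint T S.
Proof.
move=> TS; have [M TM] := bop_bounded T; have [N SN] := bop_bounded S.
have h (x : ell2 R I) (j : J) : inner (T x) (ket R j) = inner x (S (ket R j)).
  apply/eqP; rewrite -subr_eq0; apply/eqP.
  apply: (@bounded_scalar_eq0 I (fun x => inner (T x) (ket R j) - inner x (S (ket R j)))
    (M + l2norm (S (ket R j)))) => {x}.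
  - by move=> a x y; rewrite linearP !inner_linear_l; ring.
  - move=> x; apply: (le_trans (le_normcD _ _)).
    rewrite normcN mulrDl lerD//; last by rewrite mulrC cauchy_schwarz.
    by apply: (le_trans (cauchy_schwarz _ _)); rewrite l2norm_ket mulr1.
  - by move=> i; rewrite inner_ket -[X in _ - X]inner_conj inner_ket TS subrr.
move=> x y; rewrite -[LHS]inner_conj -[RHS]inner_conj; congr (_^*); apply/eqP.
rewrite -subr_eq0; apply/eqP.
apply: (@bounded_scalar_eq0 J (fun y => inner y (T x) - inner (S y) x)
  (l2norm (T x) + N * l2norm x)) => {y}.
- by move=> a y z; rewrite linearP !inner_linear_l; ring.
- move=> y; apply: (le_trans (le_normcD _ _)).
  rewrite normcN mulrDl lerD//; first by rewrite mulrC cauchy_schwarz.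
  rewrite (le_trans (cauchy_schwarz _ _))// mulrAC ler_wpM2r ?l2norm_ge0//.
- move=> j; rewrite -[X in X - _]inner_conj h.
  by rewrite [X in X - _]inner_conj subrr.
Qed.

Lemma is_adjoint_uniq I J (T : bop R I J) (S S' : bop R J I) :
  is_adjoint T S -> is_adjoint T S' -> S = S'.
Proof.
move=> TS TS'; apply: bop_ext => y; apply: ell2_ext => i.
by rewrite -inner_ket -[RHS]inner_ket -inner_conj -[RHS]inner_conj -TS TS'.
Qed.

(** Once an adjoint is exhibited, the set from which [badj] chooses is a singleton. *)
Lemma badjE I J (T : bop R I J) (S : bop R J I) : is_adjoint T S -> badj T = S.
Proof.
move=> TS; apply: (is_adjoint_uniq _ TS).
by apply: (@xgetPex _ (bzero R J I) [set S | is_adjoint T S]); exists S.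
Qed.

End Density.

(** * Neumann series and contractivity of representations *)

Section CStarNorm.
Context {R : realType} {A : cstarAlgType R}.
Implicit Types a b h : A.

Lemma cnorm0 : cnorm (0 : A) = 0.
Proof. by rewrite -(scale0r (0 : A)) cnormZ ComplexField.Normc.normc0 mul0r. Qed.

Lemma cnormN a : cnorm (- a) = cnorm a.
Proof. by rewrite -scaleN1r cnormZ normcN ComplexField.Normc.normc1 mul1r. Qed.

Lemma cnorm_ge0 a : 0 <= cnorm a.
Proof.
have := cnormD a (- a); rewrite subrr cnorm0 cnormN -mulr2n.
by rewrite pmulrn_lge0.
Qed.

Lemma cnorm_distC a b : cnorm (a - b) = cnorm (b - a).
Proof. by rewrite -opprB cnormN. Qed.

Lemma star1 : star (1 : A) = 1.
Proof.
by rewrite -[RHS](@starK _ A) -[in RHS](mulr1 (star 1)) starM starK mulr1.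
Qed.

Lemma cnorm1_le : cnorm (1 : A) <= 1.
Proof.
have := cnorm_star (1 : A); rewrite star1 mulr1 expr2 => n1.
rewrite leNgt; apply/negP => lt1; have n0 := lt_trans ltr01 lt1.
by have := lt1; rewrite -(ltr_pM2l n0) mulr1 -n1 ltxx.
Qed.

Lemma cnormX_le h n : cnorm (h ^+ n) <= cnorm h ^+ n.
Proof.
elim: n => [|n IHn]; first by rewrite !expr0 cnorm1_le.
by rewrite !exprS (le_trans (cnormM _ _))// ler_wpM2l ?cnorm_ge0.
Qed.

(** The factor [1 - cnorm h] makes the bound telescope without division; the offset [m] covers the
    tails of the Neumann series. *)
Lemma cnorm_geometric_le h m k : cnorm h <= 1 ->
  (1 - cnorm h) * cnorm (\sum_(i < k) h ^+ (m + i)) <=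
  cnorm h ^+ m - cnorm h ^+ (m + k).
Proof.
move=> h1; elim: k => [|k IHk].
  by rewrite big_ord0 cnorm0 mulr0 addn0 subrr.
rewrite big_ord_recr /=; apply: (@le_trans _ _ ((1 - cnorm h) *
    (cnorm (\sum_(i < k) h ^+ (m + i)) + cnorm h ^+ (m + k)))).
  rewrite ler_wpM2l ?subr_ge0// (le_trans (cnormD _ _))// lerD2l.
  exact: cnormX_le.
rewrite mulrDr addnS [in leRHS]exprS.
apply: (le_trans (lerD IHk (lexx _))).
by rewrite le_eqVlt; apply/orP; left; apply/eqP; ring.
Qed.

Lemma expr_eventually_lt (q e : R) : 0 <= q -> q < 1 -> 0 < e ->
  exists N, forall n, (N <= n)%N -> q ^+ n < e.
Proof.
move=> q0 q1 e0; have /cvgrPdist_lt/(_ e e0)[N _ hN] : (GRing.exp q) @ \oo --> (0 : R).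
  by apply: cvg_expr; rewrite ger0_norm.
exists N => n Nn; have := hN n Nn.
by rewrite /= sub0r normrN; exact: le_lt_trans (ler_norm _).
Qed.

(** The partial sums [u n] of the powers of [h] are Cauchy and satisfy [u n * (1 - h) = 1 - h ^+ n];
    their limit is the inverse. *)
Lemma neumann_left_inverse h : cnorm h < 1 -> exists b, b * (1 - h) = 1.
Proof.
move=> h1; have d0 : 0 < 1 - cnorm h by rewrite subr_gt0.
pose u n := \sum_(i < n) h ^+ i.
have u_le m k : (1 - cnorm h) * cnorm (u (m + k)%N - u m) <= cnorm h ^+ m.
  rewrite /u big_split_ord /= addrAC subrr add0r.
  rewrite (le_trans (cnorm_geometric_le _ _ (ltW h1)))//.
  by rewrite gerDl oppr_le0 exprn_ge0// cnorm_ge0.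
have [|b ub] := @cnorm_complete _ A u.
  move=> e e0.
  have [|N hN] := @expr_eventually_lt _ ((1 - cnorm h) * e) (cnorm_ge0 h) h1.
    exact: mulr_gt0.
  exists N => m n Nm Nn; wlog mn : m n Nm Nn / (m <= n)%N.
    by move=> H; case/orP: (leq_total m n) => ?; [|rewrite cnorm_distC]; exact: H.
  rewrite cnorm_distC -(subnKC mn) -(ltr_pM2l d0).
  exact: le_lt_trans (u_le _ _) (hN _ Nm).
exists b; apply/eqP; rewrite -subr_eq0; apply/eqP/cnorm_eq0/eqP.
rewrite eq_le cnorm_ge0 andbT; apply/ler_addgt0Pl => e e0; rewrite addr0.
have c0 : 0 < cnorm (1 - h) + 1 by rewrite ltr_wpDl ?cnorm_ge0.
have [|N hN] := @expr_eventually_lt _ (e / 2) (cnorm_ge0 h) h1; first exact: divr_gt0.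
have [|M hM] := ub (e / 2 / (cnorm (1 - h) + 1)); first by rewrite !divr_gt0.
pose n := maxn N M.
have -> : b * (1 - h) - 1 = - ((u n - b) * (1 - h)) - h ^+ n.
  have un : u n * (1 - h) = 1 - h ^+ n.
    elim: (n) => [|k IHk]; first by rewrite /u big_ord0 mul0r expr0 subrr.
    rewrite /u big_ord_recr /= mulrDl IHk mulrBr mulr1 exprSr addrA.
    by rewrite subrK.
  by rewrite mulrBl un opprB -addrA -opprD subrK.
rewrite (le_trans (cnormD _ _))// !cnormN (splitr e) lerD//.
  rewrite (le_trans (cnormM _ _))//.
  apply: (@le_trans _ _ (e / 2 / (cnorm (1 - h) + 1) * (cnorm (1 - h) + 1))).
    by rewrite ler_pM ?cnorm_ge0 ?lerDl// ltW// hM// leq_maxr.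
  by rewrite divfK// gt_eqF.
by rewrite (le_trans (cnormX_le _ _))// ltW// hN// leq_maxl.
Qed.

End CStarNorm.

(** The left-hand side is $|x-m^{-1}y|^2$ with $p=|x|^2$, $q=\langle x,y\rangle$ real and $s=|y|^2$;
    the quadratic term absorbs half of the cross term. *)
Lemma completed_square_le (R : realType) (m p q s : R) : 0 < m -> s <= m * q ->
  p - 2 * m^-1 * q + m^-1 ^+ 2 * s <= p - m^-1 * q.
Proof.
move=> m0 sq; have : m^-1 ^+ 2 * s <= m^-1 * q.
  by rewrite expr2 -mulrA ler_pM2l ?invr_gt0// ler_pdivrMl.
by lra.
Qed.

Section Contractivity.
Context {R : realType} {I : choiceType} {A : cstarAlgType R}.
Variable rho : A -> bop R I I.
Hypothesis rhoP : is_representation rho.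

Lemma rep_star_inner a x y : inner (rho (star a) x) y = inner x (rho a y).
Proof. by rewrite (rep_star rhoP) starK. Qed.

(* [m - a^* a] has a left inverse [c] by the Neumann series, so
   [|x| <= |rho c| |(m - rho (a^* a)) x|]; expanding the square of the right-hand
   side shows that [m] is not the optimal bound on [|rho a x|^2 / |x|^2]. *)
Lemma rep_bound_improve a (m : R) : 0 < m -> cnorm a ^+ 2 < m ->
  (forall x, l2norm (rho a x) ^+ 2 <= m * l2norm x ^+ 2) ->
  exists m', [/\ 0 <= m', m' < m &
    forall x, l2norm (rho a x) ^+ 2 <= m' * l2norm x ^+ 2].
Proof.
move=> m0 am am_bnd.
have [|b bP] := @neumann_left_inverse _ A (m^-1%:C%C *: (star a * a)).
  rewrite cnormZ cnorm_star normc_real.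
  by rewrite gtr0_norm ?invr_gt0// mulrC ltr_pdivrMr// mul1r.
have [K K0 bK] := bop_sqsum (rho b).
have K1 : 0 < K + 1 by rewrite ltr_wpDl.
(* Obtained by solving $|x|^2\le (K+1)(|x|^2-m^{-1}|u|^2)$ for $|u|^2$; [K + 1] replaces [K] so as
   to be invertible. *)
exists (m * (1 - (K + 1)^-1)); split.
- by rewrite mulr_ge0 ?(ltW m0)// subr_ge0 invf_le1// lerDr.
- by rewrite gtr_pMr// ltrBlDr ltrDl invr_gt0.
move=> x; set u := rho a x; pose v := rho (star a) u.
(* The bound [m] passes from [rho a] to its adjoint, because $|u-m^{-1}\rho(a)v|^2\ge 0$ and
   $\langle u,\rho(a)v\rangle=|v|^2$. *)
have v_le : l2norm v ^+ 2 <= m * l2norm u ^+ 2.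
  have uv : inner u (rho a v) = (l2norm v ^+ 2)%:C%C.
    by rewrite -rep_star_inner inner_sqr.
  have := sqr_ge0 (l2norm (u - m^-1%:C%C *: rho a v)).
  rewrite (l2normB_real_inner _ uv).
  move=> /le_trans/(_ (completed_square_le _ m0 (am_bnd v))).
  by rewrite subr_ge0 mulrC ler_pdivrMr// mulrC.
have xv : inner x v = (l2norm u ^+ 2)%:C%C.
  by rewrite /v -(rep_star rhoP) inner_sqr.
have xE : x = rho b (x - m^-1%:C%C *: v).
  have -> : x - m^-1%:C%C *: v = rho (1 - m^-1%:C%C *: (star a * a)) x.
    rewrite (_ : 1 - _ = (- m^-1%:C%C) *: (star a * a) + 1); last first.
      by rewrite scaleNr addrC.
    rewrite (rep_linear rhoP) (rep_unit rhoP) (rep_mul rhoP).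
    by rewrite scaleNr addrC.
  have := congr1 (fun T : bop R I I => T x) (rep_mul rhoP b (1 - m^-1%:C%C *: (star a * a))).
  by rewrite bP (rep_unit rhoP).
have := bK (x - m^-1%:C%C *: v); rewrite -xE !sqsumE -EFinM lee_fin.
have -> := l2normB_real_inner m^-1 xv; move=> /le_trans.
move=> /(_ _ (ler_wpM2l K0 (completed_square_le _ m0 v_le))) h.
have {h} : l2norm x ^+ 2 <= (K + 1) * (l2norm x ^+ 2 - m^-1 * l2norm u ^+ 2).
  rewrite mulrDl mul1r (le_trans h)// lerDl.
  by rewrite subr_ge0 mulrC ler_pdivrMr// mulrC am_bnd.
rewrite mulrC -ler_pdivrMr// => h.
rewrite -mulrA mulrBl mul1r -ler_pdivrMl// lerBrDr addrC -lerBrDr.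
by rewrite [_ * l2norm x ^+ 2]mulrC.
Qed.

(** The infimum of the admissible constants is itself admissible, so [rep_bound_improve] would
    contradict its minimality if it exceeded [cnorm a ^+ 2]. *)
Lemma rep_contractive a x : l2norm (rho a x) <= cnorm a * l2norm x.
Proof.
pose E := [set m : R | 0 <= m /\ forall x, l2norm (rho a x) ^+ 2 <= m * l2norm x ^+ 2].
have E0 : E !=set0.
  have [M M0 aM] := bop_sqsum (rho a); exists M; split => // y.
  by have := aM y; rewrite !sqsumE -EFinM lee_fin.
have lbE : lbound E 0 by move=> m [].
have EI : E (inf E).
  split; first exact: lb_le_inf.
  move=> y; have [y0|y0] := eqVneq (l2norm y) 0.
    have [m [_ /(_ y)]] := E0; by rewrite y0 expr0n !mulr0.
  have yp : 0 < l2norm y ^+ 2 by rewrite exprn_gt0// lt_def y0 l2norm_ge0.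
  rewrite -ler_pdivrMr//; apply: lb_le_inf => // m [_ /(_ y)].
  by rewrite ler_pdivrMr.
have : inf E <= cnorm a ^+ 2.
  rewrite leNgt; apply/negP => lt_m.
  have [|m' [m'0 m'lt m'P]] := rep_bound_improve _ lt_m EI.2.
    exact: le_lt_trans (sqr_ge0 _) lt_m.
  have : inf E <= m' by apply: ge_inf => //; exists 0.
  by rewrite leNgt m'lt.
move=> le_m; rewrite -ler_sqr ?nnegrE ?mulr_ge0 ?l2norm_ge0 ?cnorm_ge0//.
by rewrite (le_trans (EI.2 x))// exprMn ler_wpM2r ?sqr_ge0.
Qed.

End Contractivity.

(** * Universality *)

(** Closedness is sequential, in the very form in which [cnorm_complete] delivers a limit. *)
Record closed_star_subalgebra (R : realType) (A : cstarAlgType R)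
    (S : {pred A}) : Prop := ClosedStarSubalgebra {
  subalg_subalg : GRing.subalg_closed S ;
  subalg_star : forall a, a \in S -> star a \in S ;
  subalg_lim : forall (u : nat -> A) (l : A), (forall n, u n \in S) ->
    (forall e : R, 0 < e -> exists N, forall n,
      (N <= n)%N -> cnorm (u n - l) < e) -> l \in S
}.

(* The proof that [S] is closed is an argument of [subalg_pred], so that the
   algebra structures below can be inferred from the type. *)
Definition subalg_pred (R : realType) (A : cstarAlgType R) (S : {pred A})
  (SP : closed_star_subalgebra S) : {pred A} := S.

HB.instance Definition _ (R : realType) (A : cstarAlgType R) (S : {pred A})
    (SP : closed_star_subalgebra S) :=
  GRing.isSubalgClosed.Build R[i] A (subalg_pred SP) (subalg_subalg SP).

Section SubAlgebra.
Context {R : realType} {A : cstarAlgType R} {S : {pred A}}.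
Variable SP : closed_star_subalgebra S.

Record subalg := Subalg { subalg_val :> A; subalg_valP : subalg_val \in subalg_pred SP }.

HB.instance Definition _ := [isSub for subalg_val].
HB.instance Definition _ := [Choice of subalg by <:].
HB.instance Definition _ := [SubChoice_isSubAlgebra of subalg by <:].

Definition subalg_star_fun (a : subalg) : subalg :=
  Subalg (subalg_star SP (subalg_valP a)).

Let starK : involutive subalg_star_fun.
Proof. by move=> a; apply: val_inj; rewrite /= starK. Qed.

Let starD : {morph subalg_star_fun : a b / a + b}.
Proof. by move=> a b; apply: val_inj; rewrite /= starD. Qed.

Let starZ (c : R[i]) a : subalg_star_fun (c *: a) = c^* *: subalg_star_fun a.
Proof. by apply: val_inj; rewrite /= starZ. Qed.

Let starM a b :
  subalg_star_fun (a * b) = subalg_star_fun b * subalg_star_fun a.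
Proof. by apply: val_inj; rewrite /= starM. Qed.

Let norm (a : subalg) : R := cnorm (val a).

Let norm_eq0 a : norm a = 0 -> a = 0.
Proof. by move=> /cnorm_eq0 a0; exact: val_inj. Qed.

Let normD a b : norm (a + b) <= norm a + norm b.
Proof. exact: cnormD. Qed.

Let normZ (c : R[i]) a : norm (c *: a) = normc c * norm a.
Proof. exact: cnormZ. Qed.

Let normM a b : norm (a * b) <= norm a * norm b.
Proof. exact: cnormM. Qed.

Let norm_star a : norm (subalg_star_fun a * a) = norm a ^+ 2.
Proof. exact: cnorm_star. Qed.

Let norm_complete (u : nat -> subalg) :
  (forall e : R, 0 < e -> exists N, forall m n,
    (N <= m)%N -> (N <= n)%N -> norm (u m - u n) < e) ->
  exists l : subalg, forall e : R, 0 < e -> exists N, forall n,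
    (N <= n)%N -> norm (u n - l) < e.
Proof.
move=> /(@cnorm_complete _ _ (val \o u))[l ul].
by exists (Subalg (subalg_lim SP (fun n => subalg_valP (u n)) ul)).
Qed.

HB.instance Definition _ := isCStarAlgebra.Build R subalg
  starK starD starZ starM norm_eq0 normD normZ normM norm_star norm_complete.

End SubAlgebra.

Section UniversalGenerated.
Context {R : realType} {A : cstarAlgType R} {alpha beta : A}.
Hypothesis Auniv : is_universal0 alpha beta.

(* Initiality gives a map [f] from [A] to the subalgebra; composed with the
   inclusion it is an endomorphism fixing the generators, that is the identity. *)
Lemma universal0_ind (S : {pred A}) : closed_star_subalgebra S ->
  alpha \in S -> beta \in S -> forall a, a \in S.
Proof.
move=> SP aS bS a; have [Arel Ainit] := Auniv.
pose B := subalg SP.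
have Brel : suq2_rel0 (Subalg (SP := SP) aS : B) (Subalg (SP := SP) bS : B).
  by case: Arel => ? ? ? ? ?; split; exact: val_inj.
have [f [[[f_lin f_mon f_star] fa fb] _]] := Ainit _ _ _ Brel.
have [g [_ g_uniq]] := Ainit _ _ _ Arel.
have idE : g = idfun by apply: g_uniq; split => //; split => //; split.
have fE : g = (fun x => val (f x)).
  apply: g_uniq; split; rewrite ?fa ?fb//; split.
  - by move=> c x y; rewrite f_lin.
  - by split=> [|x y]; rewrite ?f_mon.1 ?f_mon.2.
  - by move=> x; rewrite f_star.
have -> : a = val (f a) by rewrite -[LHS]/(idfun a) -idE fE.
exact: subalg_valP.
Qed.

Lemma universal0_rep_eq (I : choiceType) (rho1 rho2 : A -> bop R I I) :
  is_representation rho1 -> is_representation rho2 ->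
  rho1 alpha = rho2 alpha -> rho1 beta = rho2 beta -> rho1 =1 rho2.
Proof.
move=> r1 r2 ea eb; pose S : {pred A} := fun a => `[< rho1 a = rho2 a >].
suff SP : closed_star_subalgebra S.
  by move=> a; apply/asboolP; apply: (universal0_ind SP); exact/asboolP.
split.
- split.
  + by apply/asboolP; rewrite (rep_unit r1) (rep_unit r2).
  + move=> c a b /asboolP ha /asboolP hb; apply/asboolP; apply: bop_ext => x.
    by rewrite (rep_linear r1) (rep_linear r2) ha hb.
  + move=> a b /asboolP ha /asboolP hb; apply/asboolP.
    by rewrite (rep_mul r1) (rep_mul r2) ha hb.
(* Both images of [star a] are adjoints of the same operator. *)
- move=> a /asboolP ha; apply/asboolP.
  apply: (is_adjoint_uniq (rep_star r1 a)); rewrite ha; exact: rep_star.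
- move=> u l uS ul; apply/asboolP; apply: bop_ext => x.
  have repB rho (r : is_representation rho) a b : rho (a - b) x = rho a x - rho b x.
    by rewrite -scaleN1r addrC (rep_linear r) scaleN1r addrC.
  apply/eqP; rewrite -subr_eq0; apply/eqP/l2norm_eq0/eqP.
  rewrite eq_le l2norm_ge0 andbT; apply/ler_addgt0Pl => e e0; rewrite addr0.
  (* Each of the two representations contributes an error of at most [cnorm (u N - l) * l2norm x];
     the [+ 1] allows [x = 0]. *)
  have c0 : 0 < 2 * l2norm x + 1 by rewrite ltr_wpDl// mulr_ge0// l2norm_ge0.
  have [|N /(_ N (leqnn N)) uN] := ul (e / (2 * l2norm x + 1)).
    exact: divr_gt0.
  have -> : rho1 l x - rho2 l x = rho2 (u N - l) x - rho1 (u N - l) x.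
    have /asboolP uNS := uS N.
    by rewrite !repB// uNS opprB [RHS]addrC addrA subrK.
  apply: (le_trans (l2normB _ _)).
  apply: (le_trans (lerD (rep_contractive r2 _ _) (rep_contractive r1 _ _))).
  rewrite -mulr2n -mulr_natl mulrCA.
  apply: (le_trans (ler_wpM2r _ (ltW uN))); first by rewrite mulr_ge0 ?l2norm_ge0.
  by rewrite -mulrA ger_pMr// mulrC ler_pdivrMr// mul1r lerDl.
Qed.

End UniversalGenerated.

(** * Amplification and unitary conjugation *)

Section Amplification.
Context {R : realType} {I J : choiceType}.

Lemma ket_pair (i : I) (j : J) : ket R (i, j) = tensv (ket R i) (ket R j).
Proof.
by apply: ell2_ext => -[i' j'] /=; rewrite xpair_eqE -natrM mulnb.
Qed.

Lemma slice_ampl (T : bop R J J) (x : ell2 R (I * J)%type) i :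
  slice (ampl I T x) i = T (slice x i).
Proof. exact: ell2_ext. Qed.

(** The two flips cancel by computation, after which $I\otimes T$ can be handled slice by slice. *)
Lemma btens_bid (T : bop R J J) : btens (bid R I) T = ampl I T.
Proof. by apply: bop_ext => x; apply: ell2_ext => -[i j]. Qed.

Lemma amplE (T : bop R J J) (x : ell2 R I) (y : ell2 R J) :
  ampl I T (tensv x y) = tensv x (T y).
Proof. by rewrite -btens_bid btensE. Qed.

Lemma ampl_representation (A : cstarAlgType R) (rho : A -> bop R J J) :
  is_representation rho -> is_representation (fun a => ampl I (rho a)).
Proof.
move=> rhoP; split.
- by move=> c a b x; apply: ell2_ext => -[i j] /=; rewrite (rep_linear rhoP).
- by apply: bop_ext => x; apply: ell2_ext => -[i j] /=; rewrite (rep_unit rhoP).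
- move=> a b; apply: bop_ext => x; apply: ell2_ext => -[i j].
  by rewrite /= slice_ampl (rep_mul rhoP).
(* A matrix entry of the amplification is a Kronecker delta times an entry of [rho a], so
   adjointness is inherited entrywise. *)
- move=> a; apply: is_adjoint_ket => -[i j] [i' j'].
  rewrite !ket_pair !amplE /= rmorphM /= conjC_nat -!(inner_ket _ j') -!(inner_ket _ j).
  by rewrite inner_conj -(rep_star rhoP) [i' == i]eq_sym.
Qed.

End Amplification.

Lemma conj_representation (R : realType) (I J : choiceType) (A : cstarAlgType R)
    (rho : A -> bop R J J) (U : bop R I J) (V : bop R J I) :
  is_adjoint U V -> cancel U V -> cancel V U ->
  is_representation rho ->
  is_representation (fun a => bcomp V (bcomp (rho a) U)).
Proof.
move=> UV UK VK rhoP; split.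
- by move=> c a b x /=; rewrite (rep_linear rhoP) linearP.
- by apply: bop_ext => x /=; rewrite (rep_unit rhoP) /= UK.
- by move=> a b; apply: bop_ext => x /=; rewrite (rep_mul rhoP) /= VK.
- have VU x y : inner (V x) y = inner x (U y).
    by rewrite -inner_conj -UV inner_conj.
  by move=> a x y /=; rewrite VU (rep_star rhoP) UV.
Qed.

(** A sign is real and its own inverse, so the operator that reverses the bijection with the same
    signs is both adjoint and inverse. *)
Lemma signed_basis_unitary (R : realType) (I J : choiceType) (U : bop R I J)
    (k : J -> I) (s : J -> nat) : bijective k ->
  (forall p, U (ket R (k p)) = (-1) ^+ s p *: ket R p) ->
  exists V : bop R J I, [/\ is_adjoint U V, cancel U V, cancel V U &
    forall p, V (ket R p) = (-1) ^+ s p *: ket R (k p)].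
Proof.
move=> [h kh hk] Uk; have k_inj := can_inj kh.
have [||V VE] := @weighted_partial_injection R J I (Some \o k)
    (fun p => (-1) ^+ s p).
- by move=> p p' i /= [<-] [] /k_inj.
- by move=> p; rewrite normc_sign.
exists V; split => //=.
- apply: is_adjoint_ket => i p; rewrite VE /= -(hk i) Uk.
  rewrite [LHS](_ : _ = (-1) ^+ s (h i) * (p == h i)%:R)//.
  rewrite [X in X^*](_ : _ = (-1) ^+ s p * (k (h i) == k p)%:R)//.
  rewrite rmorphM rmorphXn rmorphN1 /= conjC_nat (inj_eq k_inj) eq_sym.
  by have [->|_] := eqVneq; rewrite ?mulr0.
- suff VU : bcomp V U = bid R I by move=> x; rewrite -[LHS]/(bcomp V U x) VU.
  apply: bop_eq_ket => i; rewrite /= -(hk i) Uk linearZ /= VE.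
  by rewrite scalerA -exprMn mulrNN mulr1 expr1n scale1r.
- suff UV : bcomp U V = bid R J by move=> x; rewrite -[LHS]/(bcomp U V x) UV.
  apply: bop_eq_ket => p; rewrite /= VE /= linearZ /= Uk.
  by rewrite scalerA -exprMn mulrNN mulr1 expr1n scale1r.
Qed.

(** * The unitary U *)

Definition gamma_coord (p : nat * (nat * int)) : rat * rat * rat :=
  let: (r, (s, t)) := p in
  ((r%:R + s%:R + `|t%:~R|) / 2, (- r%:R + s%:R - t%:~R) / 2,
   (- r%:R + s%:R + t%:~R) / 2).

(** This is $t_-=\max(-t,0)$; [Negz m] denotes $-(m+1)$. *)
Definition negpart (t : int) : nat := if t is Negz m then m.+1 else 0.

Lemma normr_negpart (t : int) : `|t%:~R| = t%:~R + 2 * (negpart t)%:R :> rat.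
Proof.
case: t => m; rewrite /negpart; first by rewrite mulr0 addr0 ger0_norm ?ler0n.
by rewrite NegzE mulrNz normrN ger0_norm ?ler0n// -pmulrn; ring.
Qed.

(** From $|t|=t+2t_-$ one gets $n+i=s+t_-$ and $n+j=s+t_+$, which are natural numbers; $t_+$ is
    written [negpart (- t)]. *)
Lemma in_Gamma_coord p : in_Gamma (gamma_coord p).
Proof.
case: p => r [s t] /=; have r0 := ler0n rat r.
have t0 := normr_ge0 (t%:~R : rat); have tge := ler_norm (t%:~R : rat).
have tN : - t%:~R <= `|t%:~R| :> rat by rewrite -normrN ler_norm.
have tnat : `|t%:~R| \is a @Num.nat rat.
  by rewrite natrEint normr_ge0 andbT -intr_norm intr_int.
have h x y : x = y -> y \is a @Num.nat rat -> x \is a Num.nat by move=> ->.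
apply/and5P; split.
- apply: (h _ (r%:R + s%:R + `|t%:~R|)); last by rewrite !rpredD ?natr_nat.
  by rewrite mulr2n; lra.
- apply: (h _ (s%:R + (negpart t)%:R)); last by rewrite rpredD ?natr_nat.
  by rewrite normr_negpart; lra.
- by lra.
- apply: (h _ (s%:R + (negpart (- t))%:R)); last by rewrite rpredD ?natr_nat.
  have := normr_negpart (- t); rewrite mulrNz normrN => ->; lra.
- by lra.
Qed.

Definition gamma_of p : Gamma := Sub (gamma_coord p) (in_Gamma_coord p).

Lemma ketG_coord (R : realType) p : let: (n, i, j) := gamma_coord p in
  ketG R n i j = ket R (gamma_of p).
Proof.
have := in_Gamma_coord p; rewrite /gamma_of.
move: (in_Gamma_coord p); case: (gamma_coord p) => -[n i] j H H'.
by rewrite /ketG insubT; congr (ket R _); exact: val_inj.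
Qed.

Lemma gamma_of_inj : injective gamma_of.
Proof.
move=> [r [s t]] [r' [s' t']] /(congr1 val) [n i j].
(* The difference $j-i$ determines $t$; with $t$ shared, the absolute values agree and the rest is
   linear. *)
have tt' : t = t'.
  by apply/eqP; rewrite -(eqr_int rat); apply/eqP; lra.
rewrite -tt' in n i j *.
have -> : r = r' by apply/eqP; rewrite -(eqr_nat rat); apply/eqP; lra.
by have -> : s = s' by apply/eqP; rewrite -(eqr_nat rat); apply/eqP; lra.
Qed.

(** This says that [gamma_coord] inverts the index map of $U$ and that the signs match; the sign of
    $t=j-i$ decides which of $i,j$ is the maximum. *)
Lemma gamma_coord_minmax p : let: (r, (s, t)) := p in
  let: (n, i, j) := gamma_coord p in
  [/\ n - Num.max i j = r%:R, n + Num.min i j = s%:R, j - i = t%:~R &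
    Num.max i j - j = (negpart t)%:R].
Proof.
case: p => r [s t] /=; have := normr_negpart t.
case: (leP 0 (t%:~R : rat)) => t0 ->.
  have -> : (negpart t)%:R = 0 :> rat.
    by have := normr_negpart t; rewrite ger0_norm//; lra.
  by rewrite max_r ?min_l; [split; lra|lra|lra].
have : (t%:~R : rat) + (negpart t)%:R = 0.
  by have := normr_negpart t; rewrite ltr0_norm//; lra.
by move=> tn; rewrite max_l ?min_r; [split; lra|lra|lra].
Qed.

Lemma gamma_of_surj g : exists p, gamma_of p = g.
Proof.
case: g => -[[n i] j] H; have [_ /natrP[r nr] /natrP[s ns] /intrP[t nt]] := in_Gamma_int H.
exists (r, (s, t)); apply: val_inj => /=.
rewrite -nr -ns -nt; case: (leP i j) => ij.
  by rewrite ger0_norm ?subr_ge0//; congr (_, _, _); lra.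
by rewrite ltr0_norm ?subr_lt0//; congr (_, _, _); lra.
Qed.

Lemma gamma_of_bij : bijective gamma_of.
Proof.
have surj g : exists p, gamma_of p == g by have [p <-] := gamma_of_surj g; exists p.
exists (fun g => xchoose (surj g)) => [p|g]; last exact/eqP/(xchooseP (surj g)).
by apply: gamma_of_inj; exact/eqP/(xchooseP (surj _)).
Qed.

(** * The generators in the coordinates $(r,s,t)$ *)

Section Intertwining.
Context {R : realType}.

Lemma Umult_gamma_of p :
  Umult R (ket R (gamma_of p)) = (-1) ^+ negpart p.2.2 *: ket R p.
Proof.
have := gamma_coord_minmax p; have := ketG_coord R p.
have := in_Gamma_coord p.
case: p => r [s t] /= + <- [nr ns nt nk].
move=> /(UmultE R)[r' [s' [k' [t' []]]]].
rewrite nr ns nt nk => -[/eqP rr /eqP ss /eqP tt /eqP kk] ->.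
move: rr ss tt kk; rewrite !eqr_nat eqr_int.
by move=> /eqP -> /eqP -> /eqP -> /eqP ->.
Qed.

Definition ladder_alpha (p : nat * (nat * int)) : ell2 R Gamma :=
  if p.2.1 is s.+1 then ket R (gamma_of (p.1, (s, p.2.2))) else 0.

(** The two nonzero cases of $\lambda_0(\beta_0)$ merge into one shift of $t$ at $s=0$: $j=-n$ means
    $s=0$ and $t\le 0$, where $|t-1|=|t|+1$ raises $n$ and the sign is negative; the other case is
    $s=0$ and $t>0$, where $n$ drops. *)
Definition ladder_beta (p : nat * (nat * int)) : ell2 R Gamma :=
  if p.2.1 is s.+1 then 0 else
  (-1) ^+ (p.2.2 <= 0)%R *: ket R (gamma_of (p.1, (0%N, p.2.2 - 1))).

(** Since $n+i=s+t_-$ and $n+j=s+t_+$, and one of $t_-,t_+$ vanishes, the condition $i,j>-n$ amounts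
    to $s>0$; lowering $n,i,j$ by $1/2$ lowers $s$ by one and fixes $r,t$. *)
Lemma is_lambda0_alpha (A : cstarAlgType R) (alpha beta : A) lambda p :
  is_lambda0 alpha beta lambda ->
  lambda alpha (ket R (gamma_of p)) = ladder_alpha p.
Proof.
case: p => r [s t] lambdaP.
have := lambda0_alpha lambdaP (in_Gamma_coord (r, (s, t))).
have /= -> := ketG_coord R (r, (s, t)); move=> ->.
have r0 := ler0n rat r.
have tge := ler_norm (t%:~R : rat); have tle := ler_norm (- t%:~R : rat).
rewrite normrN in tle.
rewrite /ladder_alpha /=; case: s => [|s].
  rewrite ifF//; apply/negbTE/negP => /andP[].
  case: (leP 0 (t%:~R : rat)) => t0.
    by rewrite ger0_norm//; lra.
  by rewrite ltr0_norm//; lra.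
have s0 := ler0n rat s; rewrite -natr1 ifT; last by apply/andP; split; lra.
rewrite -[RHS](ketG_coord R (r, (s, t))) /=; congr ketG; lra.
Qed.

Lemma is_lambda0_beta (A : cstarAlgType R) (alpha beta : A) lambda p :
  is_lambda0 alpha beta lambda ->
  lambda beta (ket R (gamma_of p)) = ladder_beta p.
Proof.
case: p => r [s t] lambdaP.
have := lambda0_beta lambdaP (in_Gamma_coord (r, (s, t))).
have /= -> := ketG_coord R (r, (s, t)); move=> ->.
have r0 := ler0n rat r.
have tge := ler_norm (t%:~R : rat); have tle := ler_norm (- t%:~R : rat).
rewrite normrN in tle.
rewrite /ladder_beta /=; case: s => [|s]; last first.
  have s0 := ler0n rat s; rewrite -natr1 !ifF//; apply/negbTE/negP => /eqP; lra.
rewrite -(ketG_coord R (r, (0%N, t - 1))) /= intrB.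
have [t0|t0] := lerP t 0.
  have {}t0 : t%:~R <= 0 :> rat by rewrite lerz0.
  rewrite !ler0_norm//; last by lra.
  rewrite ifT; last by apply/eqP; lra.
  by rewrite expr1 scaleN1r; congr (- ketG R _ _ _); lra.
have {}t0 : 1 <= t%:~R :> rat by rewrite -[1]/(1%:~R) ler_int.
rewrite !ger0_norm//; [|lra|lra].
rewrite ifF; last by apply/negbTE/negP => /eqP; lra.
rewrite ifT; last by apply/eqP; lra.
by rewrite expr0 scale1r; congr ketG; lra.
Qed.

Lemma ampl_pi0_alpha (A : cstarAlgType R) (alpha beta : A) pi p :
  is_pi0 alpha beta pi ->
  ampl nat (pi alpha) (ket R p) =
  if p.2.1 is s.+1 then ket R (p.1, (s, p.2.2)) else 0.
Proof.
move=> piP; case: p => r [[|s] t];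
  rewrite !ket_pair amplE (pi0_alpha piP) btensE shiftNE //=.
  by apply: ell2_ext => -[? [? ?]] /=; rewrite mul0r mulr0.
by rewrite !ket_pair.
Qed.

Lemma ampl_pi0_beta (A : cstarAlgType R) (alpha beta : A) pi p :
  is_pi0 alpha beta pi ->
  ampl nat (pi beta) (ket R p) =
  if p.2.1 is s.+1 then 0 else ket R (p.1, (0%N, p.2.2 - 1)).
Proof.
move=> piP; case: p => r [[|s] t];
  rewrite !ket_pair amplE (pi0_beta piP) btensE proj0E shiftZE //=.
by apply: ell2_ext => -[? [? ?]] /=; rewrite mul0r mulr0.
Qed.

End Intertwining.

(** For $t\le 0$ the exponent is $2|t|+1$, and for $t>0$ it is $0$. This reconciles the signs of $U$
    with the one in $\lambda_0(\beta_0)$. *)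
Lemma sign_negpart (K : pzRingType) (t : int) :
  (-1) ^+ (negpart t + negpart (t - 1)) = (-1) ^+ (t <= 0)%R :> K.
Proof.
case: t => [[|m]|m]; rewrite -signr_odd.
- by [].
- by rewrite -addn1 PoszD addrK.
- have -> : Negz m - 1 = Negz m.+1 by rewrite !NegzE -opprD -PoszD addn1.
  by rewrite oddD /=; case: (odd m).
Qed.

Lemma bopZ (R : realType) (I J : choiceType) (T : bop R I J) c x :
  T (c *: x) = c *: T x.
Proof. exact: linearZ. Qed.

Lemma bcompE (R : realType) (I J K : choiceType) (S : bop R J K)
  (T : bop R I J) x : bcomp S T x = S (T x).
Proof. by []. Qed.

Theorem theorem2p2 (R : realType) (A0 : cstarAlgType R) (alpha0 beta0 : A0)
    (HA0 : is_universal0 alpha0 beta0)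
    (lambda0 : A0 -> bop R Gamma Gamma)
    (Hlambda0 : is_lambda0 alpha0 beta0 lambda0)
    (pi0 : A0 -> bop R (nat * int)%type (nat * int)%type)
    (Hpi0 : is_pi0 alpha0 beta0 pi0) (a : A0) :
  bcomp (bcomp (Umult R) (lambda0 a)) (badj (Umult R)) =
  btens (bid R nat) (pi0 a).
Proof.
have [V [UV UK VK VE]] := signed_basis_unitary gamma_of_bij (@Umult_gamma_of R).
have [h _ hK] := gamma_of_bij.
rewrite (badjE UV) btens_bid.
have -> : lambda0 a = bcomp V (bcomp (ampl nat (pi0 a)) (Umult R)).
  apply: (universal0_rep_eq HA0 (lambda0_rep Hlambda0)
    (conj_representation UV UK VK (ampl_representation (pi0_rep Hpi0)))).
  - apply: bop_eq_ket => g; rewrite -(hK g).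
    rewrite (is_lambda0_alpha _ Hlambda0) !bcompE Umult_gamma_of !bopZ.
    rewrite (ampl_pi0_alpha _ Hpi0); case: (h g) => r [[|s] t] /=.
      by rewrite linear0 scaler0.
    by rewrite VE scalerA -exprMn mulrNN mulr1 expr1n scale1r.
  - apply: bop_eq_ket => g; rewrite -(hK g).
    rewrite (is_lambda0_beta _ Hlambda0) !bcompE Umult_gamma_of !bopZ.
    rewrite (ampl_pi0_beta _ Hpi0); case: (h g) => r [[|s] t] /=.
      (* [Umult R] contributes the sign at [t] and [V] the sign at [t - 1]. *)
      by rewrite VE scalerA -exprD sign_negpart.
    by rewrite linear0 scaler0.
by apply: bop_ext => x /=; rewrite !VK.
Qed.
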